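(* There is an absolute constant $c$ such that the following holds. Fix $r,k,t\in\mathbb N$. Let $V$ be a finite set equipped with: (i) a binary relation $E\subseteq V\times V$ such that for all $A\subseteq V$ and $B\subseteq V$, the relation $E\cap(A\times B)\subseteq A\times B$ has a duality of order $k$; (ii) a pseudometric $\mathrm{dist}\colon V\times V\to\mathbb R_{\ge0}\cup\{+\infty\}$; (iii) a partition $\mathcal P$ of $V$ with $|\mathcal P|\le t$; such that whenever $u,v,u',v'\in V$ satisfy $\mathrm{dist}(u,v)>r$, $\mathrm{dist}(u',v')>r$, $C(u)=C(u')$ and $C(v)=C(v')$, we have $(u,v)\in E\iff(u',v')\in E$. Then there is a set $S\subseteq V$ with $|S|\le c\cdot k t^2$ such that whenever $u,v,u',v'\in V$ satisfy $\mathrm{dist}(u,v)>5r$, $\mathrm{dist}(u',v')>5r$, $E(u,S)=E(u',S)$ and $E(S,v)=E(S,v')$, we have $(u,v)\in E\iff(u',v')\in E$.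
   Context: A pseudometric here is a symmetric function $V\times V\to\mathbb R_{\ge0}\cup\{+\infty\}$ satisfying the triangle inequality. For $v\in V$, $C(v)$ denotes the unique part of $\mathcal P$ containing $v$. $E(u,S)=\{s\in S:(u,s)\in E\}$ and $E(S,v)=\{s\in S:(s,v)\in E\}$. A relation $R\subseteq A\times B$ has a duality of order $k$ if (a) there is $A'\subseteq A$, $|A'|\le k$, such that for every $b\in B$ some $a\in A'$ has $(a,b)\notin R$, or (b) there is $B'\subseteq B$, $|B'|\le k$, such that for every $a\in A$ some $b\in B'$ has $(a,b)\in R$. *)

(* Defs.v *)
From HB Require Import structures.
From mathcomp Require Import all_boot all_order all_algebra.
From mathcomp Require Import reals constructive_ereal.

Set Implicit Arguments.
Unset Strict Implicit.
Unset Printing Implicit Defensive.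

(* Symmetry and the triangle inequality only: [d x x = 0] is not required. *)
Definition pseudometric (R : realType) (V : Type) (d : V -> V -> \bar R) : Prop :=
  [/\ forall x y, (0 <= d x y)%E,
      forall x y, d x y = d y x
    & forall x y z, (d x z <= d x y + d y z)%E].

(* The relation in question is [r] restricted to [A] x [B]; the restriction is
   implicit, as [r] is only evaluated on pairs from [A] x [B]. *)
Definition has_duality (T1 T2 : finType) (r : T1 -> T2 -> bool)
    (A : {set T1}) (B : {set T2}) (k : nat) : Prop :=
  (exists A' : {set T1},
     [/\ A' \subset A, #|A'| <= k
       & forall b, b \in B -> exists2 a, a \in A' & ~~ r a b])
  \/
  (exists B' : {set T2},
     [/\ B' \subset B, #|B'| <= k
       & forall a, a \in A -> exists2 b, b \in B' & r a b]).

Definition out_nbrs (V : finType) (E : rel V) (u : V) (S : {set V}) : {set V} :=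
  [set s in S | E u s].

Definition in_nbrs (V : finType) (E : rel V) (S : {set V}) (v : V) : {set V} :=
  [set s in S | E s v].

(* Main.v *)
(** Call two points far when they are more than [r] apart. Each part [A] of
    the partition gets at most three centers: either three points of [A] that are
    pairwise more than [2r] apart, one of which is then far from any two given
    points, or points whose [2r]-balls cover [A]. Around each center [x] and for
    each part [B], [S] also receives the duality witnesses for the part of [x]
    within [2r] of [x] against [B] within [r] of [x], in both orders.
    Now let [E u v] and [~ E u' v'] hold, both pairs being more than [5r] apart.
    If some center [x] in the part of [u] is far from [v] and [v'], and some
    center [y] in the part of [v'] is far from [u] and [u'], then [E x v'] and
    [~ E u y], contradicting homogeneity on far pairs. Otherwise [u] and [v'] lie
    around a common center, and a duality witness there separates [v] from [v']
    or [u] from [u']. *)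
Require Import Defs.
From HB Require Import structures.
From mathcomp Require Import all_boot all_order all_algebra.
From mathcomp Require Import reals constructive_ereal.
From mathcomp Require Import zify.

Set Implicit Arguments.
Unset Strict Implicit.
Unset Printing Implicit Defensive.

(** [near n x y] stands for distance at most [n * r]. Only comparisons with integer multiples of [r]
    matter, so this keeps extended reals out of the combinatorics. *)
Definition graded_nearness (V : Type) (near : nat -> rel V) : Prop :=
  [/\ forall n, symmetric (near n),
      forall m n x y z, near m x y -> near n y z -> near (m + n) x z
    & forall m n x y, m <= n -> near m x y -> near n x y].

(** An unrelated pair in [A] either extends to a triple or is itself a net; without such a pair, any
    single point of [A] is a net. *)
Lemma three_points_or_net (V : finType) (e : rel V) (A : {set V}) :
  symmetric e ->
  (exists x y z, [/\ [set x; y; z] \subset A, ~~ e x y, ~~ e x z & ~~ e y z]) \/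
  (exists N : {set V}, [/\ N \subset A, #|N| <= 2
     & forall u, u \in A -> exists2 x, x \in N & e u x]).
Proof.
move=> e_sym.
case: (set_0Vmem A) => [->|[w wA]].
  by right; exists set0; split; rewrite ?cards0 // => u; rewrite inE.
have [/exists_inP[x xA /exists_inP[y yA exy]]|all_e] :=
    boolP [exists x in A, [exists y in A, ~~ e x y]]; last first.
  right; exists [set w]; split; rewrite ?cards1 ?sub1set // => u uA.
  exists w; rewrite ?set11 //; apply/negPn/negP => euw.
  by case/negP: all_e; apply/exists_inP; exists u => //; apply/exists_inP; exists w.
have [/exists_inP[z zA /andP[exz eyz]]|all_e] :=
    boolP [exists z in A, ~~ e x z && ~~ e y z].
  by left; exists x, y, z; split; rewrite // !subUset !sub1set xA yA zA.
right; exists [set x; y]; split; first by rewrite subUset !sub1set xA yA.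
  by rewrite cards2; case: (x != y).
move=> u uA; move/exists_inPn: all_e => /(_ u uA).
rewrite negb_and !negbK => /orP[exu|eyu].
  by exists x; rewrite ?set21 // e_sym.
by exists y; rewrite ?set22 // e_sym.
Qed.

(** Given three centers pairwise not [near 2], each of [v] and [v'] is [near 1] to at most one, so
    one center avoids both. Given a net, a center within [2] of [u] is not within [1] of [v], since
    [2 + 1 = 3]; only [v'] remains to be tested. *)
Lemma part_centers (V : finType) (near : nat -> rel V) (A : {set V}) :
  graded_nearness near ->
  exists N : {set V}, [/\ N \subset A, #|N| <= 3
    & forall u v v', u \in A -> ~~ near 3 u v ->
      (exists2 x, x \in N & ~~ near 1 x v && ~~ near 1 x v') \/
      (exists2 x, x \in N & near 2 x u && near 1 x v')].
Proof.
case=> near_sym near_tri _.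
have [[x [y [z [sA nxy nxz nyz]]]]|[N [sNA cN net]]] :=
    three_points_or_net A (near_sym 2).
  exists [set x; y; z]; split => //.
    by rewrite (leq_trans (leq_card_setU _ _)) // cards1 cards2; case: (x != y).
  move=> u v v' _ _; left.
  have far a b w : ~~ near 2 a b -> ~~ (near 1 a w && near 1 b w).
    by apply: contra => /andP[aw bw]; apply: (near_tri 1 1 _ w); rewrite // near_sym.
  suff : [|| ~~ near 1 x v && ~~ near 1 x v', ~~ near 1 y v && ~~ near 1 y v'
           | ~~ near 1 z v && ~~ near 1 z v'].
    by case/or3P=> H; [exists x | exists y | exists z]; rewrite // !inE eqxx ?orbT.
  move: (far _ _ v nxy) (far _ _ v nxz) (far _ _ v nyz).
  move: (far _ _ v' nxy) (far _ _ v' nxz) (far _ _ v' nyz).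
  by case: (near 1 x v) (near 1 y v) (near 1 z v)
           (near 1 x v') (near 1 y v') (near 1 z v') => [] [] [] [] [] [].
exists N; split => // [|u v v' uA nuv]; first by rewrite (leq_trans cN).
have [x xN ux] := net u uA.
have [xv'|nxv'] := boolP (near 1 x v').
  by right; exists x; rewrite // near_sym ux.
left; exists x; rewrite // nxv' andbT; apply: contra nuv => xv.
exact: (near_tri 2 1 _ _ _ ux xv).
Qed.

(** [D] is the witness set of whichever alternative of duality holds. Recording only what it yields
    for each pair gives both alternatives one form. *)
Definition duality_witnesses (V : finType) (E : rel V) (k : nat)
    (AB : {set V} * {set V}) (D : {set V}) : Prop :=
  #|D| <= k /\
  forall u v, u \in AB.1 -> v \in AB.2 ->
    (exists2 a, a \in D :&: AB.1 & ~~ E a v) \/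
    (exists2 b, b \in D :&: AB.2 & E u b).

Lemma has_duality_witnesses (V : finType) (E : rel V) (k : nat) (AB : {set V} * {set V}) :
  has_duality E AB.1 AB.2 k -> exists D, duality_witnesses E k AB D.
Proof.
case=> -[D [/subsetP sD cD hD]]; exists D; split=> // u v uA vB.
  by left; have [a aD na] := hD v vB; exists a; rewrite // inE aD sD.
by right; have [b bD nb] := hD u uA; exists b; rewrite // inE bD sD.
Qed.

Lemma leq_card_bigcup (I T : finType) (A : {set I}) (F : I -> {set T}) (m : nat) :
  (forall i, i \in A -> #|F i| <= m) -> #|\bigcup_(i in A) F i| <= #|A| * m.
Proof.
move=> hF; rewrite -sum_nat_const.
apply: (@leq_trans (\sum_(i in A) #|F i|)); last exact: leq_sum.
elim/big_rec2: _ => [|i n U _ IH]; first by rewrite cards0.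
by rewrite (leq_trans (leq_card_setU _ _)) // leq_add2l.
Qed.

(** The radius [5] is [2 + 2 + 1]: a witness sharing with [u] a ball of radius at most [2] around a
    center is within [4] of [u], hence not within [1] of [v]. The same count applies to [v'] and
    [u']. *)
Lemma no_separated_far_pairs (V : finType) (E : rel V) (near : nat -> rel V)
    (T : Type) (cls : V -> T) (N S : {set V}) :
  graded_nearness near ->
  (forall u v u' v', ~~ near 1 u v -> ~~ near 1 u' v' ->
     cls u = cls u' -> cls v = cls v' -> E u v = E u' v') ->
  N \subset S ->
  (forall u v v', ~~ near 3 u v ->
     (exists x, [/\ x \in N, cls x = cls u, ~~ near 1 x v & ~~ near 1 x v']) \/
     (exists x, [/\ x \in N, cls x = cls u, near 2 x u & near 1 x v'])) ->
  (forall x u v, x \in N ->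
     (cls x = cls u /\ near 2 x u /\ near 1 x v) \/
     (cls x = cls v /\ near 1 x u /\ near 2 x v) ->
     exists m n, [/\ m <= 2, n <= 2, near m x u, near n x v &
     (exists a, [/\ a \in S, cls a = cls u, near m x a & ~~ E a v]) \/
     (exists b, [/\ b \in S, cls b = cls v, near n x b & E u b])]) ->
  forall u v u' v', ~~ near 5 u v -> ~~ near 5 u' v' ->
    (forall s, s \in S -> E u s = E u' s) ->
    (forall s, s \in S -> E s v = E s v') ->
    E u v -> E u' v'.
Proof.
move=> [near_sym near_tri near_le] homog /subsetP sNS centers dual.
move=> u v u' v' nuv nuv' eqS eqS' Euv; apply/negPn/negP => nE.
have le_far m n x y : m <= n -> ~~ near n x y -> ~~ near m x y.
  by move=> le_mn; apply/contra/near_le.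
have around x : x \in N ->
    (cls x = cls u /\ near 2 x u /\ near 1 x v') \/
    (cls x = cls v' /\ near 1 x u /\ near 2 x v') -> False.
  (* A witness [a] on the side of [u] gives [E a v' = E a v] because [a] is in [S], and
     [E a v = E u v] by homogeneity, against [~~ E a v']. *)
  move=> xN /(dual _ _ _ xN)[m [n [le_m le_n xu xv' [[a [aS ca xa /negP[]]]|]]]].
    rewrite -eqS' // (homog a v u v) //; last exact: (le_far 1 5).
    apply: contra nuv => av; rewrite near_sym in xu.
    apply: (near_le (m + m + 1)); first by rewrite -[5]/(2 + 2 + 1) !leq_add.
    exact: near_tri (near_tri _ _ _ _ _ xu xa) av.
  (* A witness [b] on the side of [v'] gives [E u b = E u' b = E u' v'] in the same way. *)
  case=> b [bS cb xb Eub]; move: Eub nE.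
  rewrite eqS // (homog u' b u' v') //; [by move=> -> | | exact: (le_far 1 5)].
  apply: contra nuv' => u'b.
  apply: (near_le (1 + (n + n))); first by rewrite -[5]/(1 + (2 + 2)) !leq_add.
  by apply: near_tri u'b (near_tri _ _ _ _ _ _ xv'); rewrite near_sym.
have nuv3 : ~~ near 3 u v by exact: (le_far 3 5).
have nuv3' : ~~ near 3 v' u' by rewrite near_sym; exact: (le_far 3 5).
case: (centers u v v' nuv3) => [[x [xN cx nxv nxv']]|[x [xN cx ? ?]]]; last first.
  by apply: (around x) => //; left.
case: (centers v' u' u nuv3') => [[y [yN cy nyu' nyu]]|[y [yN cy ? ?]]]; last first.
  by apply: (around y) => //; right.
(* Membership of [x] and [y] in [S] gives [E x v' = E x v = E u v] and [E u y = E u' y = E u' v'],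
   whereas homogeneity forces [E u y = E x v']. *)
have Exv' : E x v'.
  by rewrite -eqS' ?sNS // (homog x v u v) //; exact: (le_far 1 5).
have /negP[] : ~~ E u y.
  rewrite eqS ?sNS // (homog u' y u' v') //; first by rewrite near_sym.
  exact: (le_far 1 5).
by rewrite (homog u y x v') // near_sym.
Qed.

Lemma out_nbrs_inj (V : finType) (E : rel V) (S : {set V}) (u u' : V) :
  out_nbrs E u S = out_nbrs E u' S -> {in S, E u =1 E u'}.
Proof. by move=> eqS s sS; move/setP/(_ s): eqS; rewrite !inE sS. Qed.

Lemma in_nbrs_inj (V : finType) (E : rel V) (S : {set V}) (v v' : V) :
  in_nbrs E S v = in_nbrs E S v' -> {in S, E^~ v =1 E^~ v'}.
Proof. by move=> eqS s sS; move/setP/(_ s): eqS; rewrite !inE sS. Qed.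

Lemma graded_nearness_pseudometric (R : realType) (V : Type)
    (dist : V -> V -> \bar R) (r : nat) :
  pseudometric dist ->
  graded_nearness (fun n x y => dist x y <= (n * r)%:R%:E)%E.
Proof.
case=> _ dist_sym dist_tri; split=> [n x y|m n x y z xy yz|m n x y le_mn xy].
- by rewrite dist_sym.
- apply: Order.POrderTheory.le_trans (dist_tri x y z) _.
  by rewrite mulnDl GRing.natrD EFinD leeD.
- apply: Order.POrderTheory.le_trans xy _.
  by rewrite lee_fin Num.Theory.ler_nat leq_mul2r le_mn orbT.
Qed.

Theorem theorem3p5 :
  exists c : nat,
  forall (R : realType) (r k t : nat) (V : finType)
    (E : rel V) (dist : V -> V -> \bar R) (P : {set {set V}}),
  (forall A B : {set V}, has_duality E A B k) ->
  pseudometric dist ->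
  partition P [set: V] ->
  #|P| <= t ->
  (forall u v u' v' : V,
     (r%:R%:E < dist u v)%E -> (r%:R%:E < dist u' v')%E ->
     pblock P u = pblock P u' -> pblock P v = pblock P v' ->
     (E u v <-> E u' v')) ->
  exists S : {set V},
    #|S| <= c * (k * t ^ 2) /\
    forall u v u' v' : V,
      ((5 * r)%:R%:E < dist u v)%E -> ((5 * r)%:R%:E < dist u' v')%E ->
      out_nbrs E u S = out_nbrs E u' S -> in_nbrs E S v = in_nbrs E S v' ->
      (E u v <-> E u' v').
Proof.
(* The count is [3 * t] centers plus [2 * k] witnesses for each center and part, so
   [3 * t + 6 * k * t ^ 2]; the first term is absorbed once [k] and [t] are positive. *)
exists 9 => R r k t V E dist P dual dist_pm partP cP homog.
set near := fun (n : nat) (x y : V) => (dist x y <= (n * r)%:R%:E)%E.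
have near_graded : graded_nearness near by exact: graded_nearness_pseudometric.
have near_sym : forall n, symmetric (near n) by case: near_graded.
have farE n x y : ((n * r)%:R%:E < dist x y)%E = ~~ near n x y.
  by rewrite Order.TotalTheory.ltNge.
have [N hN] := fin_all_exists (fun A => part_centers A near_graded).
have [D hD] := fin_all_exists (fun AB => has_duality_witnesses (dual AB.1 AB.2)).
have in_pblock u : u \in pblock P u by rewrite mem_pblock (cover_partition partP) inE.
have pblock_in u : pblock P u \in P by rewrite pblock_mem // (cover_partition partP) inE.
have triv := partition_trivIset partP.
pose ball n x := [set y | near n x y].
pose N0 := \bigcup_(A in P) N A.
(* [D1] serves centers in the part of the source of a pair, [D2] those in the part of its target. *)
pose D1 x B := D (ball 2 x :&: pblock P x, ball 1 x :&: B).
pose D2 x B := D (ball 1 x :&: B, ball 2 x :&: pblock P x).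
pose S := N0 :|: \bigcup_(x in N0) \bigcup_(B in P) (D1 x B :|: D2 x B).
have cN0 : #|N0| <= 3 * t.
  apply: (@leq_trans (#|P| * 3)); last by rewrite mulnC leq_mul2l.
  by apply: leq_card_bigcup => A _; case: (hN A).
have sub1 x B : x \in N0 -> B \in P -> D1 x B :|: D2 x B \subset S.
  move=> xN BP; apply: subset_trans (subsetUr _ _).
  by apply: subset_trans (bigcup_sup x xN); exact: (bigcup_sup B BP).
exists S; split.
  have cS : #|S| <= 3 * t + 3 * t * (t * (k + k)).
    apply: leq_trans (leq_card_setU _ _) _; apply: leq_add => //.
    apply: (@leq_trans (#|N0| * (t * (k + k)))); last by rewrite leq_mul2r cN0 orbT.
    apply: leq_card_bigcup => x _.
    apply: (@leq_trans (#|P| * (k + k))); last by rewrite leq_mul2r cP orbT.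
    apply: leq_card_bigcup => B _; apply: leq_trans (leq_card_setU _ _) _.
    exact: leq_add (proj1 (hD _)) (proj1 (hD _)).
  (* A point of [S] makes [V] nonempty: then [P] has a part, and duality on all of [V] needs a
     witness, so [t] and [k] are positive. *)
  have [->|[w _]] := set_0Vmem S; first by rewrite cards0.
  have t_gt0 : 0 < t.
    by apply: leq_trans cP; apply/card_gt0P; exists (pblock P w).
  have k_gt0 : 0 < k.
    by case: (dual setT setT) => -[D' [_ cD' /(_ w (in_setT w))[a aD' _]]];
      apply: leq_trans cD'; apply/card_gt0P; exists a.
  apply: leq_trans cS _; nia.
have homog' u v u' v' : ~~ near 1 u v -> ~~ near 1 u' v' ->
    pblock P u = pblock P u' -> pblock P v = pblock P v' -> E u v = E u' v'.
  by rewrite -!farE mul1n => ? ? ? ?; apply/idP/idP; apply homog.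
have N0_cls u x : x \in N (pblock P u) -> x \in N0 /\ pblock P x = pblock P u.
  move=> xN; split; first by apply/bigcupP; exists (pblock P u).
  by apply: def_pblock => //; case: (hN (pblock P u)) => /subsetP/(_ x xN).
have key := no_separated_far_pairs near_graded homog' (subsetUl _ _ : N0 \subset S).
have {}key u v u' v' : ~~ near 5 u v -> ~~ near 5 u' v' ->
    out_nbrs E u S = out_nbrs E u' S -> in_nbrs E S v = in_nbrs E S v' ->
    E u v -> E u' v'.
  move=> nuv nuv' eqS eqS'; apply: key => //.
  - move=> a b b' nab.
    case: (hN (pblock P a)) => _ _ /(_ a b b' (in_pblock a) nab).
    by case=> -[x /N0_cls[xN0 cx] /andP[? ?]]; [left | right]; exists x.
  - move=> {eqS eqS' nuv nuv'} x {}u {}v xN [[cx [xu xv]]|[cx [xu xv]]].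
    + exists 2, 1; split=> //.
      have /subsetP sS := sub1 x (pblock P v) xN (pblock_in v).
      case: (hD (ball 2 x :&: pblock P x, ball 1 x :&: pblock P v)) => _ /(_ u v).
      rewrite /= !inE xu xv cx !in_pblock => /(_ isT isT)[[a]|[b]] => /setIP[sD];
        rewrite !inE => /andP[? c] ?; [left; exists a | right; exists b];
        split; rewrite // ?(def_pblock triv _ c) // sS // !inE /D1 cx sD //.
    + exists 1, 2; split=> //.
      have /subsetP sS := sub1 x (pblock P u) xN (pblock_in u).
      case: (hD (ball 1 x :&: pblock P u, ball 2 x :&: pblock P x)) => _ /(_ u v).
      rewrite /= !inE xu xv cx !in_pblock => /(_ isT isT)[[a]|[b]] => /setIP[sD];
        rewrite !inE => /andP[? c] ?; [left; exists a | right; exists b];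
        split; rewrite // ?(def_pblock triv _ c) // sS // !inE /D2 cx sD orbT //.
  - exact: out_nbrs_inj.
  - exact: in_nbrs_inj.
move=> u v u' v'; rewrite !farE => nuv nuv' eqS eqS'.
(* The hypotheses are symmetric in the two pairs, so one implication gives both. *)
by split; apply: key.
Qed.
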